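(* Let $\mathbb{F}_q$ be a finite field, $\mathcal{V}$ a vector space over $\mathbb{F}_q$, and $k,t$ integers with $0\le t\le k$. Let $n\ge 2$ and let $\mathcal{C}=\{\pi_1,\ldots,\pi_n\}$ be a $(k,k-t)$-SCID in $\mathcal{V}$. Define $S:=\langle \pi_1,\ldots,\pi_n\rangle$ and $I:=\langle \pi_i\cap\pi_j \mid 1\le i<j\le n\rangle$. Suppose $(n-1)(k-t)\le k$. Then $\dim S+\dim I=nk$ if and only if there exist $(k-t)$-dimensional subspaces $V_{ij}$ for each $1\le i<j\le n$, and $(k-(n-1)(k-t))$-dimensional subspaces $U_i$ for each $1\le i\le n$, such that: (1) for each $1\le i<j\le n$, $V_{ij}=\pi_i\cap\pi_j$; (2) for each $1\le i\le n$, $\pi_i=\langle U_i,\ \pi_i\cap\pi_j \mid j\neq i\rangle$; (3) $\dim\langle U_i, V_{lj} \mid i\in\{1,\ldots,n\},\ 1\le l<j\le n\rangle = n(k-(n-1)(k-t))+\frac{n(n-1)}{2}(k-t)$.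
   Context: A $(k,k-t)$-SCID is a set of (distinct) $k$-dimensional subspaces of $\mathcal{V}$, containing at least two elements, such that any two distinct members intersect in a subspace of dimension exactly $k-t$. $\langle\cdot\rangle$ denotes the span. *)

(* Defs.v *)
From mathcomp Require Import all_boot all_order all_algebra.
From mathcomp Require Import boolp classical_sets.
Set Implicit Arguments.
Unset Strict Implicit.
Unset Printing Implicit Defensive.
Import GRing.Theory.
Local Open Scope ring_scope.
Local Open Scope classical_set_scope.

(* The ambient space is an arbitrary [lmodType] over a field, possibly of
   infinite dimension, so [{vspace _}], [span], [free] and [\dim] (restricted to
   [vectType]) do not apply; subspaces are sets closed under linear
   combinations. *)
Section Subspaces.
Variables (F : fieldType) (V : lmodType F).

Definition subspace (W : set V) : Prop := submod_closed [in W].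

Definition lspan (A : set V) : set V := smallest subspace A.

Definition lin_independent (d : nat) (b : 'I_d -> V) : Prop :=
  forall c : 'I_d -> F, \sum_i c i *: b i = 0 -> forall i, c i = 0.

(* [has_dim W d]: W is a subspace of finite dimension d.  A relation rather
   than a function, so that no default value is given to infinite-dimensional
   subspaces. *)
Definition has_dim (W : set V) (d : nat) : Prop :=
  subspace W /\
  exists b : 'I_d -> V, lin_independent b /\ lspan (range b) = W.

(* A (k, m)-SCID: a set of Subspaces with Constant Intersection Dimension. *)
Definition SCID (k m : nat) (C : set (set V)) : Prop :=
  [/\ exists A B, [/\ C A, C B & A <> B],
      forall A, C A -> has_dim A k
    & forall A B, C A -> C B -> A <> B -> has_dim (A `&` B) m].

End Subspaces.

(* Main.v *)
(** In both directions the span [S] is finite-dimensional, hence the image of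
    a coordinate space under an injective linear map, and everything can be
    computed there with dimensions.

    Write [I_T] for the span of the pairwise intersections of the [pi_i] with
    [i] in [T], [S_T] for the span of these [pi_i], and [J_i] for the span of
    the [pi_i :&: pi_j], [j] in [T].  Adding an index [i] to [T], the modular
    law and [J_i <= S_T :&: pi_i] give
      [dim S_(i + T) + dim I_(i + T) + dim (I_T :&: J_i)
         <= dim S_T + dim I_T + k],
    so [dim S_T + dim I_T <= #|T| k].  If equality holds for all [n] indices,
    then [J_i] meets the span of the intersections avoiding [i] trivially, for
    every [i].  Hence [pi_i :&: pi_l], which lies in [J_l], meets the span of
    the [pi_i :&: pi_j], [j <> i, l], trivially: [J_i] is a direct sum of
    dimension [(n - 1)(k - t)], any complement of it in [pi_i] can serve as
    [U_i], and the remaining dimensions are forced by counting. *)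
From HB Require Import structures.
Require Import Defs.
From mathcomp Require Import all_boot all_order all_algebra.
From mathcomp Require Import zify.
Set Implicit Arguments.
Unset Strict Implicit.
Unset Printing Implicit Defensive.
Import GRing.Theory.

(** * Dimensions of pairwise intersections *)

Section PairwiseIntersections.
Variables (F : fieldType) (E : vectType F) (n : nat) (P : 'I_n -> {vspace E}).
Implicit Types (T : {set 'I_n}) (i j l : 'I_n) (k m : nat).
Local Open Scope vspace_scope.

(** The J_i of the overview; [i] may lie inside or outside [T]. In [caps_in], the I_T of the
    overview, every intersection occurs for both orders of its indices, so no order on the indices
    is needed until dimensions are counted. *)
Definition caps_with i T : {vspace E} :=
  \sum_(j in T | j != i) (P i :&: P j).

Definition caps_in T : {vspace E} := \sum_(i in T) caps_with i T.

Lemma sub_caps_with i j T : j \in T -> j != i -> P i :&: P j <= caps_with i T.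
Proof.
by move=> jT ji; apply: (sumv_sup j); rewrite ?jT ?ji ?subvv.
Qed.

Lemma sub_caps_in i j T :
  i \in T -> j \in T -> j != i -> P i :&: P j <= caps_in T.
Proof.
by move=> iT jT ji; apply: (sumv_sup i) => //; apply: sub_caps_with.
Qed.

Lemma caps_inU1 i T : caps_in (i |: T) <= caps_in T + caps_with i T.
Proof.
apply/subv_sumP => l lT; apply/subv_sumP => j /andP[jT jl].
move: lT jT; rewrite !in_setU1.
case/predU1P => [li|lT] /predU1P[ji|jT].
- by rewrite ji li eqxx in jl.
- by apply: subv_trans (addvSr _ _); rewrite li; apply: sub_caps_with; rewrite -?li.
- apply: subv_trans (addvSr _ _); rewrite ji capvC.
  by apply: sub_caps_with => //; rewrite -ji eq_sym.
- by apply: subv_trans (addvSl _ _); apply: sub_caps_in.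
Qed.

Lemma dim_sum_caps_inU1 i T : i \notin T ->
  (\dim (\sum_(j in i |: T) P j) + \dim (caps_in (i |: T))
     + \dim (caps_in T :&: caps_with i T)
   <= \dim (\sum_(j in T) P j) + \dim (caps_in T) + \dim (P i))%N.
Proof.
move=> iT.
have -> : \sum_(j in i |: T) P j = P i + \sum_(j in T) P j.
  by rewrite big_setU1.
have capS : caps_with i T <= P i :&: \sum_(j in T) P j.
  apply/subv_sumP => j /andP[jT ji]; rewrite subv_cap capvSl /=.
  by apply: (sumv_sup j) => //; apply: capvSr.
(* The modular law is used twice: for [P i] and S_T, whose intersection is bounded below by [capS],
   and for I_T and J_i, whose sum contains the new span of intersections. *)
have /dimvS := capS.
have /dimvS := caps_inU1 i T.
have := dimv_sum_cap (caps_in T) (caps_with i T).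
have := dimv_sum_cap (P i) (\sum_(j in T) P j).
lia.
Qed.

Lemma dim_sum_caps_in k T : (forall i, \dim (P i) = k) ->
  (\dim (\sum_(j in T) P j) + \dim (caps_in T) <= #|T| * k)%N.
Proof.
(* Induction on a strict bound for [#|T|]: each index removed accounts for at most [k]. *)
move=> dimP; elim: {T}_.+1 {-2}T (ltnSn #|T|) => // N IHN T leTN.
have [->|[i iT]] := set_0Vmem T.
  by rewrite /caps_in !big_set0 dimv0.
have step := @dim_sum_caps_inU1 i (T :\ i) (negbT (setD11 _ _)).
rewrite setD1K // dimP in step.
have cT := cardsD1 i T; rewrite iT in cT.
have IHT : (#|T :\ i| < N)%N by rewrite cT add1n in leTN.
apply: leq_trans (leq_trans (leq_addr _ _) step) _.
by rewrite cT mulnDl mul1n addnC leq_add2l IHN.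
Qed.

(** The other n - 1 indices contribute at most (n - 1)k, so a total of nk leaves no slack when [i]
    is added last, and the correction term of [dim_sum_caps_inU1] vanishes. *)
Lemma cap_caps_eq0 k i : (forall j, \dim (P j) = k) ->
  (\dim (\sum_j P j) + \dim (caps_in setT) = n * k)%N ->
  caps_in (setT :\ i) :&: caps_with i (setT :\ i) = 0.
Proof.
move=> dimP dimS; apply/eqP; rewrite -dimv_eq0 -leqn0.
have step := @dim_sum_caps_inU1 i (setT :\ i) (negbT (setD11 _ _)).
have sumT : \sum_(j in setT) P j = \sum_j P j.
  by apply: eq_bigl => j; rewrite inE.
rewrite setD1K ?inE // dimP sumT dimS in step.
have cT := cardsD1 i (setT : {set 'I_n}); rewrite inE cardsT card_ord in cT.
rewrite -(leq_add2l (n * k)); apply: leq_trans step _.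
by rewrite addn0 [X in (_ <= X * k)%N]cT mulnDl mul1n addnC leq_add2l dim_sum_caps_in.
Qed.

Lemma dim_caps_with k m i : (forall j, \dim (P j) = k) ->
  (forall j l, j != l -> \dim (P j :&: P l) = m) ->
  (\dim (\sum_j P j) + \dim (caps_in setT) = n * k)%N ->
  \dim (caps_with i setT) = ((n - 1) * m)%N.
Proof.
move=> dimP dimPP dimS.
suff /directvP/= dir : directv (\sum_(j in setT | j != i) (P i :&: P j)).
  rewrite /caps_with dir (eq_bigr (fun=> m)) => [|j /andP[_ ji]]; last first.
    by apply: dimPP; rewrite eq_sym.
  rewrite sum_nat_const; congr (_ * _)%N.
  have cT := cardsD1 i (setT : {set 'I_n}); rewrite inE cardsT card_ord in cT.
  by rewrite [X in (X - 1)%N]cT addKn; apply: eq_card => j; rewrite unfold_in !inE andbC.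
apply/directv_sumP => l /andP[_ li]; apply/eqP; rewrite -subv0.
(* The vanishing is used at [l], not at [i]: [P i :&: P l] passes through [l], while the other
   summands avoid [l]. *)
rewrite -[X in _ <= X](cap_caps_eq0 l dimP dimS) capvC; apply: capvS.
  apply/subv_sumP => j /andP[/andP[_ ji] jl].
  by apply: sub_caps_in; rewrite // !inE ?jl // eq_sym li.
by rewrite capvC; apply: sub_caps_with; rewrite ?inE eq_sym li.
Qed.

Lemma caps_in_ltn :
  caps_in setT = \sum_(p : 'I_n * 'I_n | (p.1 < p.2)%N) (P p.1 :&: P p.2).
Proof.
apply/eqP; rewrite eqEsubv; apply/andP; split.
  apply/subv_sumP => i _; apply/subv_sumP => j /andP[_ ji].
  have [ij|ij] := boolP (i < j)%N.
    by apply: (sumv_sup (i, j)) => //=; apply: subvv.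
  rewrite capvC; apply: (sumv_sup (j, i)); rewrite /= ?subvv //.
  by rewrite ltn_neqAle ji leqNgt.
apply/subv_sumP => -[i j] /= ij; apply: sub_caps_in; rewrite ?inE //.
by rewrite neq_ltn ij orbT.
Qed.

Lemma sum_ltn_pairs m :
  (\sum_(p : 'I_n * 'I_n | (p.1 < p.2)%N) m = (n * (n - 1)) %/ 2 * m)%N.
Proof.
rewrite -(pair_big_dep xpredT (fun i j : 'I_n => (i < j)%N) (fun _ _ => m)) /=.
(* Pairs are grouped by their larger entry [j], which leaves [j] choices for the smaller one. *)
rewrite (exchange_big_dep xpredT) //=.
under eq_bigr => j _.
  rewrite sum_nat_const.
  have -> : #|[pred i : 'I_n | (i < j)%N]| = j.
    by rewrite -sum1_card (big_ord_narrow (ltnW (ltn_ord j))) sum1_card card_ord.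
  over.
rewrite -big_distrl /= -(big_mkord xpredT id) bin2_sum bin2.
by rewrite subn1 divn2.
Qed.

Lemma dim_caps_in m : (forall j l, j != l -> \dim (P j :&: P l) = m) ->
  (\dim (caps_in setT) <= (n * (n - 1)) %/ 2 * m)%N.
Proof.
move=> dimPP; rewrite caps_in_ltn -sum_ltn_pairs.
apply: leq_trans (dimv_leq_sum _ _ _) _.
by apply: leq_sum => -[i j] /= ij; rewrite dimPP // neq_ltn ij.
Qed.

Lemma sum_addv_caps (U : 'I_n -> {vspace E}) :
  (forall i, P i = U i + caps_with i setT) ->
  \sum_i P i = \sum_i U i + caps_in setT.
Proof.
move=> PE; rewrite /caps_in (eq_bigr _ (fun i _ => PE i)) big_split /=.
by congr (_ + _); apply: eq_bigl => i; rewrite inE.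
Qed.

Lemma dim_sum_le (U : 'I_n -> {vspace E}) u :
  (forall i, \dim (U i) = u) -> (forall i, P i = U i + caps_with i setT) ->
  (\dim (\sum_i P i) <= n * u + \dim (caps_in setT))%N.
Proof.
move=> dimU /sum_addv_caps ->.
apply: leq_trans (dimv_add_leqif _ _) _; rewrite leq_add2r.
apply: leq_trans (dimv_leq_sum _ _ _) _.
by rewrite (eq_bigr _ (fun i _ => dimU i)) sum_nat_const card_ord.
Qed.

End PairwiseIntersections.

(** The hypothesis makes the truncated subtraction exact, and halving is exact because n(n - 1) is
    even. The factor 2 reflects that each pairwise intersection lies in two of the subspaces. *)
Lemma muln_compl_pairs n k m : ((n - 1) * m <= k)%N ->
  (n * k = n * (k - (n - 1) * m) + 2 * ((n * (n - 1)) %/ 2 * m))%N.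
Proof.
move=> le_k.
have /divnK e : (2 %| n * (n - 1))%N.
  by case: n {le_k} => // n; rewrite subn1 dvdn2 oddM /=; case: odd.
by rewrite mulnA (mulnC 2) e -mulnA -mulnDr subnK.
Qed.

(** * Subspaces as images under an injective linear map *)

From mathcomp Require Import boolp classical_sets.
Local Open Scope classical_set_scope.

Section Subspaces.
Local Open Scope ring_scope.
Variables (F : fieldType) (V : lmodType F).

Lemma subspaceP (W : set V) :
  subspace W <-> W 0 /\ forall a u v, W u -> W v -> W (a *: u + v).
Proof.
split=> -[W0 WD]; split; rewrite ?unfold_in /=.
- by move: W0; rewrite inE.
- by move=> a u v Wu Wv; have := WD a u v; rewrite !inE; apply.
- by rewrite inE.
- by move=> a u v; rewrite !inE; apply: WD.
Qed.

Lemma subspace_sum (W : set V) d (c : 'I_d -> F) (b : 'I_d -> V) :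
  subspace W -> (forall i, W (b i)) -> W (\sum_i c i *: b i).
Proof.
move=> /subspaceP[W0 WD] Wb; elim/big_rec: _ => // i x _; exact: WD.
Qed.

Lemma subspace_lspan (A : set V) : subspace (lspan A).
Proof.
apply/subspaceP; split=> [M [/subspaceP[M0 _] _] //|a u v Au Av M MA].
by case: (MA) => /subspaceP[_ MD] _; apply: MD; [apply: Au|apply: Av].
Qed.

Lemma lspan_range d (b : 'I_d -> V) :
  lspan (range b) = [set \sum_i c i *: b i | c in [set: 'I_d -> F]].
Proof.
apply/seteqP; split.
  apply: smallest_sub => [|_ [i _ <-]].
    apply/subspaceP; split=> [|a _ _ [c _ <-] [c' _ <-]].
      by exists (fun=> 0) => //; rewrite big1 // => i _; rewrite scale0r.
    exists (fun i => a * c i + c' i) => //.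
    rewrite scaler_sumr -big_split /=; apply: eq_bigr => i _.
    by rewrite scalerDl scalerA.
  exists (fun j => (j == i)%:R) => //.
  rewrite (bigD1 i) //= eqxx scale1r big1 ?addr0 // => j /negPf->.
  by rewrite scale0r.
move=> _ [c _ <-]; apply: subspace_sum; first exact: subspace_lspan.
by move=> i; apply: sub_gen_smallest; exists i.
Qed.

Lemma has_dim_coordinates (W : set V) d : has_dim W d ->
  exists2 phi : {linear 'rV[F]_d -> V}, injective phi & range phi = W.
Proof.
move=> [_ [b [b_free <-]]].
pose f (x : 'rV[F]_d) := \sum_i x 0 i *: b i.
have f_linear : linear f.
  move=> a x y; rewrite /f scaler_sumr -big_split /=; apply: eq_bigr => i _.
  by rewrite !mxE scalerDl scalerA.
pose fM := GRing.isLinear.Build F 'rV[F]_d V *:%R f f_linear.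
pose phi : {linear 'rV[F]_d -> V} := HB.pack f fM.
exists phi.
  move=> x y fxy; apply/rowP => i; apply/eqP; rewrite -subr_eq0; apply/eqP.
  apply: (b_free (fun i => x 0 i - y 0 i)).
  under eq_bigr do rewrite scalerBl.
  by rewrite sumrB; apply/eqP; rewrite subr_eq0; apply/eqP.
rewrite lspan_range; apply/seteqP; split=> _ [c _ <-].
  by exists (c 0).
by exists (\row_i c i) => //; apply: eq_bigr => i _; rewrite mxE.
Qed.

Variables (E : vectType F) (phi : {linear E -> V}).
Hypothesis phi_inj : injective phi.

(** The dictionary between subspaces of [E] and subspaces of [V] inside the range of [phi]; it
    respects intersections, spans and dimensions. *)
Definition vimage (W : {vspace E}) : set V :=
  [set phi w | w in [set w | w \in W]].

Lemma mem_vimage W w : vimage W (phi w) <-> w \in W.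
Proof.
by split=> [[w' Ww' /phi_inj <-]//|Ww]; exists w.
Qed.

Lemma vimage_inj : injective vimage.
Proof.
move=> W W' eqWW'; apply/vspaceP => w.
by apply/idP/idP => /mem_vimage ?; apply/mem_vimage; rewrite ?eqWW' // -eqWW'.
Qed.

Lemma vimage_sub W W' : (W <= W')%VS -> vimage W `<=` vimage W'.
Proof. by move=> sWW' _ [w Ww <-]; exists w => //; apply: (subvP sWW'). Qed.

Lemma vimage_full : vimage fullv = range phi.
Proof. by apply/seteqP; split=> _ [w _ <-]; exists w => //=; rewrite ?memvf. Qed.

Lemma subspace_vimage W : subspace (vimage W).
Proof.
apply/subspaceP; split=> [|a _ _ [u Wu <-] [v Wv <-]].
  by exists 0; rewrite ?linear0 //=; apply: mem0v.
by exists (a *: u + v); rewrite ?linearP //=; apply: rpredD; rewrite ?rpredZ.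
Qed.

Lemma vimage_cap W W' : vimage (W :&: W')%VS = vimage W `&` vimage W'.
Proof.
apply/seteqP; split=> [_ [w /memv_capP[Ww W'w] <-]|_ [[w Ww <-] /mem_vimage W'w]].
  by split; apply/mem_vimage.
by apply/mem_vimage/memv_capP.
Qed.

Lemma lspan_vimage_bigcup (T : finType) (D : pred T) (W : T -> {vspace E}) :
  lspan (\bigcup_(i in [set i | D i]) vimage (W i)) =
  vimage (\sum_(i | D i) W i)%VS.
Proof.
apply/seteqP; split.
  apply: smallest_sub; first exact: subspace_vimage.
  by move=> v [i Di]; apply: vimage_sub; apply: (sumv_sup i).
move=> _ [_ /memv_sumP[w Ww ->] <-].
have /subspaceP[L0 LD] := subspace_lspan (\bigcup_(i in [set i | D i]) vimage (W i)).
rewrite linear_sum; elim/big_rec: _ => // i x Di Lx.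
rewrite -[phi _]scale1r; apply: LD => //.
by apply: sub_gen_smallest; exists i => //; apply/mem_vimage; apply: Ww.
Qed.

Lemma lspanU_vimage (A B : set V) W W' :
  lspan A = vimage W -> lspan B = vimage W' ->
  lspan (A `|` B) = vimage (W + W')%VS.
Proof.
move=> AW BW'; apply/seteqP; split.
  apply: smallest_sub => [|v [Av|Bv]]; first exact: subspace_vimage.
    by apply: (vimage_sub (addvSl _ _)); rewrite -AW; apply: sub_gen_smallest.
  by apply: (vimage_sub (addvSr _ _)); rewrite -BW'; apply: sub_gen_smallest.
have sub_lspanU (C : set V) : C `<=` A `|` B -> lspan C `<=` lspan (A `|` B).
  by move=> ?; apply: sub_smallest2r => //; apply: subspace_lspan.
move=> _ [_ /memv_addP[u Wu [v W'v ->]] <-].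
have /subspaceP[_ LD] := subspace_lspan (A `|` B).
rewrite linearD -[phi u]scale1r; apply: LD.
  apply: (sub_lspanU A); first by move=> x; left.
  by rewrite AW; apply/mem_vimage.
apply: (sub_lspanU B); first by move=> x; right.
by rewrite BW'; apply/mem_vimage.
Qed.

(** A basis of [X] is pulled back along [phi]; a linear relation between the preimages maps to one
    between the basis vectors, so the preimages are free. *)
Lemma vimage_of_has_dim (X : set V) d : has_dim X d -> X `<=` range phi ->
  exists2 W : {vspace E}, X = vimage W & \dim W = d.
Proof.
move=> [_ [b [b_free Xb]]] sXphi.
have /choice[e eb] : forall i, exists w, phi w = b i.
  move=> i; have [|w _ <-] := sXphi (b i); last by exists w.
  by rewrite -Xb; apply: sub_gen_smallest; exists i.
pose t := [tuple e i | i < d].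
have tE (i : 'I_d) : t`_i = e i by rewrite -tnth_nth tnth_mktuple.
have t_free : free t.
  apply/freeP => c; under eq_bigr do rewrite tE.
  move=> /(congr1 phi); rewrite linear_sum linear0.
  under eq_bigr do rewrite linearZ /= eb.
  exact: b_free.
exists <<t>>%VS; last by rewrite (eqP t_free) size_tuple.
rewrite -Xb; apply/seteqP; split.
  apply: smallest_sub => [|_ [i _ <-]]; first exact: subspace_vimage.
  rewrite -eb; apply/mem_vimage/memv_span; apply/tnthP; exists i.
  by rewrite tnth_mktuple.
move=> _ [w /coord_span -> <-]; rewrite lspan_range.
exists (fun i => coord t i w) => //.
by rewrite linear_sum; apply: eq_bigr => i _; rewrite linearZ /= tE eb.
Qed.

Lemma has_dim_vimage W : has_dim (vimage W) (\dim W).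
Proof.
split; first exact: subspace_vimage.
exists (fun i => phi (vbasis W)`_i); split=> [c c0 i|].
  have /freeP : free (vbasis W) := basis_free (vbasisP W).
  apply; apply: phi_inj; rewrite linear_sum linear0 -[RHS]c0.
  by apply: eq_bigr => j _; rewrite linearZ.
apply/seteqP; split.
  apply: smallest_sub => [|_ [i _ <-]]; first exact: subspace_vimage.
  by apply/mem_vimage/vbasis_mem/mem_nth; rewrite size_tuple.
move=> _ [w /coord_vbasis -> <-]; rewrite lspan_range.
exists (fun i => coord (vbasis W) i w) => //.
by rewrite linear_sum; apply: eq_bigr => i _; rewrite linearZ.
Qed.

(** Uniqueness of the dimension in the relation [has_dim], read off in [E] by injectivity of
    [vimage]. *)
Lemma has_dim_vimageE W d : has_dim (vimage W) d -> d = \dim W.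
Proof.
move=> Wd; have [|W' /vimage_inj <- //] := vimage_of_has_dim Wd.
by rewrite -vimage_full; apply: vimage_sub; apply: subvf.
Qed.

End Subspaces.

(** * Transfer of SCIDs to coordinates, and the equivalence *)

Section SCID.
Variables (F : fieldType) (V : lmodType F) (E : vectType F).
Variables (phi : {linear E -> V}) (n : nat) (P : 'I_n -> {vspace E}).
Hypothesis phi_inj : injective phi.

Lemma lspan_vimages :
  lspan (\bigcup_i vimage phi (P i)) = vimage phi (\sum_i P i)%VS.
Proof.
rewrite -(lspan_vimage_bigcup phi_inj); congr (lspan _).
by apply/seteqP; split=> v [i _ Pv]; exists i.
Qed.

Lemma lspan_caps_ltn :
  lspan (\bigcup_(p in [set p : 'I_n * 'I_n | (p.1 < p.2)%N])
           (vimage phi (P p.1) `&` vimage phi (P p.2))) =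
  vimage phi (caps_in P finset.setT).
Proof.
rewrite caps_in_ltn -(lspan_vimage_bigcup phi_inj); congr (lspan _).
by apply: eq_bigcupr => p _; rewrite vimage_cap.
Qed.

Lemma lspan_caps_with (i : 'I_n) :
  lspan (\bigcup_(j in [set j | j != i])
           (vimage phi (P i) `&` vimage phi (P j))) =
  vimage phi (caps_with P i finset.setT).
Proof.
rewrite /caps_with; under [in RHS]eq_bigl do rewrite inE /=.
rewrite -(lspan_vimage_bigcup phi_inj); congr (lspan _).
by apply: eq_bigcupr => p _; rewrite vimage_cap.
Qed.

Lemma has_dim_vimages k m : injective (vimage phi \o P) ->
  SCID k m (range (vimage phi \o P)) ->
  (forall i, \dim (P i) = k) /\
  (forall i j, i != j -> \dim (P i :&: P j) = m).
Proof.
move=> Pinj [_ dimP dimPP]; split=> [i|i j ij].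
  by apply/esym/(has_dim_vimageE phi_inj)/dimP; exists i.
apply/esym/(has_dim_vimageE phi_inj); rewrite vimage_cap //.
(* Injectivity turns distinct indices into distinct members. *)
by apply: dimPP; [exists i|exists j|move=> /Pinj/eqP; apply/negP].
Qed.

End SCID.

Theorem theorem2 (F : finFieldType) (V : lmodType F) (k t n : nat)
    (pi : 'I_n -> set V)
    (le_tk : t <= k) (n_ge2 : 2 <= n)
    (pi_inj : injective pi)
    (pi_SCID : SCID k (k - t) (range pi))
    (le_k : (n - 1) * (k - t) <= k) :
  let S : set V := lspan (\bigcup_i pi i) in
  let I : set V :=
    lspan (\bigcup_(p in [set p : 'I_n * 'I_n | p.1 < p.2])
             (pi p.1 `&` pi p.2)) in
  (exists s d : nat, [/\ has_dim S s, has_dim I d & s + d = n * k])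
  <->
  (exists (W : 'I_n -> 'I_n -> set V) (U : 'I_n -> set V),
    [/\ forall i j : 'I_n, i < j -> has_dim (W i j) (k - t),
        forall i : 'I_n, has_dim (U i) (k - (n - 1) * (k - t)),
        forall i j : 'I_n, i < j -> W i j = pi i `&` pi j,
        forall i : 'I_n,
          pi i = lspan (U i `|` \bigcup_(j in [set j | j != i])
                                  (pi i `&` pi j))
      & has_dim
          (lspan ((\bigcup_i U i) `|`
                  \bigcup_(p in [set p : 'I_n * 'I_n | p.1 < p.2]) W p.1 p.2))
          (n * (k - (n - 1) * (k - t)) + (n * (n - 1)) %/ 2 * (k - t))]).
Proof.
set m := k - t in pi_SCID le_k *.
have dim_pi i : has_dim (pi i) k by case: pi_SCID => _ + _; apply; exists i.
have nkE := muln_compl_pairs le_k.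
move=> S I; split.
  case=> s [d [dimS dimI sd]].
  have [phi phi_inj phiS] := has_dim_coordinates dimS.
  have /choice[P piE] : forall i, exists W, pi i = vimage phi W.
    move=> i; have [|W -> _] := vimage_of_has_dim phi_inj (dim_pi i) _.
      by rewrite phiS => v piv; apply: sub_gen_smallest; exists i.
    by exists W.
  have {}piE : pi = vimage phi \o P by apply/funext.
  rewrite {}/S {}/I in dimS dimI phiS *; subst pi.
  have [dimP dimPP] := has_dim_vimages phi_inj pi_inj pi_SCID.
  rewrite lspan_vimages // in dimS; rewrite lspan_caps_ltn // in dimI.
  move/(has_dim_vimageE phi_inj) in dimS; move/(has_dim_vimageE phi_inj) in dimI.
  rewrite {}dimS {}dimI in sd.
  (* [:\:] gives a complement of the intersection of its arguments, here of J_i itself, since J_i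
     lies in [P i]. *)
  pose U i := (P i :\: caps_with P i finset.setT)%VS.
  have capsP i : (P i :&: caps_with P i finset.setT = caps_with P i finset.setT)%VS.
    by apply/capv_idPr/subv_sumP => j _; apply: capvSl.
  have dimU i : \dim (U i) = k - (n - 1) * m.
    have := dimv_cap_compl (P i) (caps_with P i finset.setT).
    by rewrite capsP (dim_caps_with i dimP dimPP sd) dimP => <-; rewrite addKn.
  have PE i : P i = (U i + caps_with P i finset.setT)%VS.
    by rewrite -{1}(addv_diff_cap (P i) (caps_with P i finset.setT)) capsP.
  exists (fun i j => vimage phi (P i) `&` vimage phi (P j)), (vimage phi \o U).
  split=> // [i j ij|i|i|] /=.
  - by rewrite -vimage_cap // -(dimPP i j) ?neq_ltn ?ij //; apply: has_dim_vimage.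
  - by rewrite -(dimU i); apply: has_dim_vimage.
  - rewrite {1}PE; apply/esym/lspanU_vimage => //; last exact: lspan_caps_with.
    by apply: smallest_id; apply: subspace_vimage.
  - rewrite (lspanU_vimage phi_inj (lspan_vimages U phi_inj)
               (lspan_caps_ltn P phi_inj)) -sum_addv_caps //.
    suff <- : \dim (\sum_i P i)%VS
              = n * (k - (n - 1) * m) + (n * (n - 1)) %/ 2 * m.
      exact: has_dim_vimage.
    (* With u = dim U_i and c = m n(n - 1)/2: dim S + dim I = nu + 2c, dim S <= nu + dim I and dim I
       <= c force dim S = nu + c. *)
    have := dim_sum_le dimU PE; have := dim_caps_in dimPP.
    rewrite nkE in sd; lia.
case=> W [U [dimW dimU WE piE dimS]].
(* Finite dimension is now known for the span in (3), which supplies the coordinates; by (2) it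
   contains every [pi i]. *)
have [phi phi_inj phiS] := has_dim_coordinates dimS.
have U_sub i : U i `<=` range phi.
  by rewrite phiS => v Uv; apply: sub_gen_smallest; left; exists i.
have pi_sub i : pi i `<=` range phi.
  rewrite piE phiS; apply: smallest_sub => [|v [Uv|[j /= ji piv]]].
  - exact: subspace_lspan.
  - by rewrite -phiS; apply: U_sub Uv.
  - apply: sub_gen_smallest; right; case: (ltngtP i j) => [ij|ij|/val_inj ij].
    + by exists (i, j) => //=; rewrite WE.
    + by exists (j, i) => //=; rewrite WE // setIC.
    + by rewrite ij eqxx in ji.
have /choice[P pE] : forall i, exists X, pi i = vimage phi X.
  move=> i; have [X -> _] := vimage_of_has_dim phi_inj (dim_pi i) (pi_sub i).
  by exists X.
have /choice[Q QP] : forall i,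
    exists X, U i = vimage phi X /\ \dim X = k - (n - 1) * m.
  move=> i; have [X] := vimage_of_has_dim phi_inj (dimU i) (U_sub i).
  by exists X.
have {}pE : pi = vimage phi \o P by apply/funext.
have QE : U = vimage phi \o Q by apply/funext => i; have [] := QP i.
have dimQ i : \dim (Q i) = k - (n - 1) * m by have [] := QP i.
rewrite {}/S {}/I; subst pi U.
have [dimP dimPP] := has_dim_vimages phi_inj pi_inj pi_SCID.
have PE i : P i = (Q i + caps_with P i finset.setT)%VS.
  apply: (vimage_inj phi_inj).
  rewrite [LHS]piE; apply: lspanU_vimage; rewrite ?lspan_caps_with //.
  by apply: smallest_id; apply: subspace_vimage.
move: dimS; rewrite (eq_bigcupr (fun p => WE p.1 p.2)).
rewrite (lspanU_vimage phi_inj (lspan_vimages Q phi_inj)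
           (lspan_caps_ltn P phi_inj)) -sum_addv_caps //.
move=> /(has_dim_vimageE phi_inj) dimS.
exists (\dim (\sum_i P i)%VS), (\dim (caps_in P finset.setT)).
split; [rewrite lspan_vimages //|rewrite lspan_caps_ltn //|]; do ?exact: has_dim_vimage.
(* Now dim S = nu + c is given, so nu + c <= nu + dim I and dim I <= c yield dim I = c, and the sum
   is nu + 2c = nk. *)
have := dim_sum_le dimQ PE; have := dim_caps_in dimPP.
rewrite -dimS nkE; lia.
Qed.
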